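(* The out-of-order membership problem for the language $a^*b^*a^*b^*a^*$ over the alphabet $\{a,b\}$ has $O(\log n)$ space complexity.
   Context: Problem. Let $\Sigma$ be a finite alphabet, let $w=w[1]\cdots w[n]$ be a word of length $n>0$ over $\Sigma$ and let $\pi$ be a permutation of $\{1,\ldots,n\}$. The out-of-order stream of $w$ defined by $\pi$ is the sequence of triples $(w[\pi(i)],\pi(i),n)$ for $i=1,\ldots,n$. In the out-of-order membership problem for a fixed language $L\subseteq\Sigma^*$, the algorithm receives the triples one after the other, for arbitrary $w$ and arbitrary $\pi$, and must decide at the end whether $w\in L$. The length $n$ is known and not counted in the space. Space. Algorithms are deterministic, and only the bits memorized between two consecutive stream elements are counted (computation time and interim memory used while processing an element are ignored). Formally, an algorithm using $s(n)$ bits consists, for each $n\ge 1$, of a set $Q_n$ of memory states with $|Q_n|\le 2^{s(n)}$, an initial state, an update function $Q_n\times\Sigma\times\{1,\ldots,n\}\to Q_n$, and an output function $Q_n\to\{\text{yes},\text{no}\}$, such that for every $w\in\Sigma^n$ and every permutation $\pi$ the output after processing the stream is correct. The problem has $O(g(n))$ space complexity if some algorithm uses $s(n)=O(g(n))$ bits. *)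

(* Defs.v *)
From HB Require Import structures.
From mathcomp Require Import all_boot all_order all_fingroup all_algebra.
From mathcomp Require Import all_classical all_reals all_analysis.
Set Implicit Arguments.
Unset Strict Implicit.
Unset Printing Implicit Defensive.
Import Order.TTheory GRing.Theory Num.Theory.
Import numFieldNormedType.Exports.
Local Open Scope classical_set_scope.

Section Languages.
Variable Sigma : eqType.

Definition language := seq Sigma -> Prop.

Definition lang_letter (c : Sigma) : language := fun u => u = [:: c].

Definition lang_cat (L1 L2 : language) : language :=
  fun u => exists u1 u2 : seq Sigma, [/\ u = u1 ++ u2, L1 u1 & L2 u2].

Definition lang_star (L : language) : language :=
  fun u => exists us : seq (seq Sigma),
    u = flatten us /\ (forall v : seq Sigma, v \in us -> L v).

End Languages.

Section OutOfOrder.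
Variable Sigma : finType.

(* Positions are numbered from 0.  The third component n of every triple of
   the stream is constant, and is carried by the type 'I_n of positions. *)
Definition ooo_stream (n : nat) (w : n.-tuple Sigma) (pi : 'S_n) :
    seq (Sigma * 'I_n) :=
  [seq (tnth w (pi i), pi i) | i <- enum 'I_n].

Record ooo_algorithm (n : nat) := OooAlgorithm {
  ooo_state : finType;
  ooo_init : ooo_state;
  ooo_update : ooo_state -> Sigma -> 'I_n -> ooo_state;
  ooo_output : ooo_state -> bool
}.

Definition ooo_run (n : nat) (A : ooo_algorithm n) (t : seq (Sigma * 'I_n)) :
    ooo_state A :=
  foldl (fun q x => ooo_update q x.1 x.2) (ooo_init A) t.

Definition ooo_decides (L : language Sigma) (n : nat) (A : ooo_algorithm n) :
    Prop :=
  forall (w : n.-tuple Sigma) (pi : 'S_n),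
    ooo_output (ooo_run A (ooo_stream w pi)) <-> L w.

(* The algorithms for different lengths are unrelated: the model is
   non-uniform.  Length 0 is excluded. *)
Definition ooo_space_bits (L : language Sigma) (s : nat -> nat) : Prop :=
  exists A : forall n : nat, ooo_algorithm n,
    forall n : nat, 0 < n ->
      #|ooo_state (A n)| <= 2 ^ s n /\ ooo_decides L (A n).

Definition ooo_space_complexity (R : realType) (L : language Sigma)
    (g : nat -> R) : Prop :=
  exists s : nat -> nat,
    ooo_space_bits L s /\ (fun n : nat => (s n)%:R%R : R) =O_\oo g.

End OutOfOrder.

Inductive ab := letter_a | letter_b.

Definition ab_to_bool (c : ab) : bool := if c is letter_a then true else false.
Definition ab_of_bool (x : bool) : ab := if x then letter_a else letter_b.
Lemma ab_to_boolK : cancel ab_to_bool ab_of_bool.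
Proof. by case. Qed.

HB.instance Definition _ := Finite.copy ab (can_type ab_to_boolK).

Definition lang_ababa : language ab :=
  let a_star := lang_star (lang_letter letter_a) in
  let b_star := lang_star (lang_letter letter_b) in
  lang_cat a_star (lang_cat b_star (lang_cat a_star (lang_cat b_star a_star))).

(* Main.v *)
Require Import Defs.
From mathcomp Require Import all_boot all_order all_algebra.
From mathcomp Require Import all_classical all_reals all_analysis.
From mathcomp Require Import perm zify lra.

(** The algorithm stores the moments [\sum_i i ^ k], [k < 5], of the set of
    positions carrying the letter [b].  If [w] lies in the language, the
    [b]-positions form at most two intervals, so a polynomial of degree 4 with
    roots between consecutive integers is positive on the [b]-positions and
    negative elsewhere.  Any set of positions with the same moments gives the
    same sum to this polynomial, and the only set maximizing that sum is the
    set of [b]-positions: the moments determine [w] among all words. *)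

Set Implicit Arguments.
Unset Strict Implicit.
Unset Printing Implicit Defensive.
Import Order.TTheory GRing.Theory Num.Theory.

Section Moments.
Local Open Scope ring_scope.

(** The sum of [p] over a set of positions is a linear combination of moments, so it agrees for [f]
    and [g]. The difference of the two sums has only nonnegative terms by the sign condition, so
    each term vanishes; as [p] is nonzero at every position, [f i = g i]. *)
Lemma moments_determine_sign_set (F : realFieldType) (n d : nat)
    (p : {poly F}) (f g : pred 'I_n) :
  (size p <= d)%N ->
  (forall i : 'I_n, if f i then 0 < p.[i%:R] else p.[i%:R] < 0) ->
  (forall k : 'I_d, (\sum_(i | f i) i ^ k = \sum_(i | g i) i ^ k)%N) ->
  f =1 g.
Proof.
move=> size_p p_sign eq_moments.
have sumE (h : pred 'I_n) : \sum_(i | h i) p.[i%:R] =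
    \sum_(k < d) p`_k * (\sum_(i | h i) i ^ k)%N%:R.
  under eq_bigr do rewrite (horner_coef_wide _ size_p).
  rewrite exchange_big; apply: eq_bigr => k _.
  by rewrite natr_sum big_distrr; apply: eq_bigr => i _; rewrite natrX.
have diff0 : \sum_i ((f i)%:R - (g i)%:R) * p.[i%:R] = 0.
  under eq_bigr do rewrite mulrBl !mulr_natl !mulrb.
  rewrite sumrB -!big_mkcond !sumE; apply/eqP; rewrite subr_eq0; apply/eqP.
  by apply: eq_bigr => k _; rewrite eq_moments.
have term_ge0 i : 0 <= ((f i)%:R - (g i)%:R) * p.[i%:R].
  by move: (p_sign i); case: (f i); case: (g i) => /=; lra.
move=> i; have := @psumr_eq0P _ _ predT _ (fun j _ => term_ge0 j) diff0 i isT.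
by move: (p_sign i); case: (f i); case: (g i) => //=; lra.
Qed.

(* Each cut is moved by 1/2 so that no root is an integer. *)
Definition cut_poly (F : realFieldType) (cuts : seq nat) : {poly F} :=
  - \prod_(c <- cuts) ('X - (c%:R - 2^-1)%:P).

Lemma size_cut_poly (F : realFieldType) (cuts : seq nat) :
  size (cut_poly F cuts) = (size cuts).+1.
Proof. by rewrite size_polyN size_prod_XsubC. Qed.

(** A factor is negative exactly when its cut lies beyond [i]. Since the number of cuts is even, the
    cuts beyond [i] and those up to [i] have the same parity. *)
Lemma sgr_cut_poly (F : realFieldType) (cuts : seq nat) (i : nat) :
  ~~ odd (size cuts) ->
  Num.sg (cut_poly F cuts).[i%:R] = - (-1) ^+ odd (count (geq i) cuts).
Proof.
move=> even_cuts; rewrite hornerN sgrN horner_prod; congr (- _).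
transitivity ((-1) ^+ odd (size cuts + count (geq i) cuts) : F); last first.
  by rewrite oddD (negbTE even_cuts).
rewrite signr_odd; elim: cuts {even_cuts} => [|c cuts IHcuts].
  by rewrite big_nil sgr1.
rewrite big_cons sgrM IHcuts /= -(add1n (size cuts)) addnACA [RHS]exprD.
congr (_ * _).
rewrite hornerXsubC; case: leqP => [le_ci|lt_ic] /=.
  have: (c%:R <= i%:R :> F) by rewrite ler_nat.
  by move=> le_ciF; rewrite gtr0_sg; [rewrite sqrrN expr1n | lra].
have: (i.+1%:R <= c%:R :> F) by rewrite ler_nat.
by rewrite -addn1 natrD => le_icF; rewrite ltr0_sg //; lra.
Qed.

End Moments.

Lemma lang_star_letter (Sigma : eqType) (c : Sigma) (u : seq Sigma) :
  lang_star (lang_letter c) u -> exists m, u = nseq m c.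
Proof.
case=> us [-> us_c]; exists (size us).
elim: us us_c => //= v us IHus us_c.
rewrite (us_c v (mem_head _ _)) /= IHus // => x us_x.
by apply: us_c; rewrite inE us_x orbT.
Qed.

Lemma lang_ababa_cuts (w : seq ab) : lang_ababa w ->
  exists2 cuts : seq nat, size cuts = 4 &
    forall i, i < size w ->
      (nth letter_a w i == letter_b) = odd (count (geq i) cuts).
Proof.
case=> u1 [v1 [-> /lang_star_letter[p ->]]].
case=> u2 [v2 [-> /lang_star_letter[q ->]]].
case=> u3 [v3 [-> /lang_star_letter[r ->]]].
case=> u4 [u5 [-> /lang_star_letter[s ->]]].
move=> /lang_star_letter[t ->].
(* The cuts are the starting positions of blocks two to five; equal cuts, produced by empty inner
   blocks, are counted with multiplicity. *)
exists [:: p; p + q; p + q + r; p + q + r + s] => // i.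
rewrite !size_cat !size_nseq => lt_iw.
rewrite !nth_cat !size_nseq !nth_nseq /=.
by do ![case: ltnP => ? | case: leqP => ?] => //=; lia.
Qed.

Section MomentAlgorithm.
Variable n : nat.

(* No moment of order less than 5 exceeds n ^ 5, so nothing is lost by
   counting modulo n ^ 5 + 1. *)
Definition moment_state := {ffun 'I_5 -> 'I_(n ^ 5).+1}.

Definition letter_moments (c : ab) (i : 'I_n) : moment_state :=
  [ffun k : 'I_5 => inZp (if c == letter_b then i ^ k else 0)].

Definition word_moments (w : n.-tuple ab) : moment_state :=
  (\sum_i letter_moments (tnth w i) i)%R.

(** The output searches through all words: only the stored state counts as space. *)
Definition moment_algorithm : ooo_algorithm ab n := @OooAlgorithm ab n
  moment_state 0%R (fun q c i => q + letter_moments c i)%R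
  (fun q => [exists w : n.-tuple ab,
    `[< lang_ababa w >] && (word_moments w == q)]).

Lemma moment_run (w : n.-tuple ab) (pi : 'S_n) :
  ooo_run moment_algorithm (ooo_stream w pi) = word_moments w.
Proof.
(* Addition of states is commutative, so the order of arrival is immaterial. *)
rewrite /word_moments (reindex_inj (@perm_inj _ pi)) /= /ooo_run /=.
rewrite -[RHS]add0r /ooo_stream /index_enum -enumT.
elim: (enum 'I_n) {1 2}0%R => [|i e IHe] q /=; first by rewrite big_nil addr0.
by rewrite IHe big_cons addrA.
Qed.

Lemma word_momentsE (w : n.-tuple ab) (k : 'I_5) : 0 < n ->
  val (word_moments w k) = \sum_(i | tnth w i == letter_b) i ^ k.
Proof.
move=> n_gt0; rewrite /word_moments sum_ffunE.
have inZpD : {morph (@inZp (n ^ 5)) : i j / i + j >-> (i + j)%R}.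
  by move=> i j; apply: val_inj; rewrite /= modnDm.
have inZp0 : inZp 0 = 0%R :> 'I_(n ^ 5).+1 by apply: val_inj; rewrite /= mod0n.
rewrite (_ : (\sum_i _)%R = inZp (\sum_(i | tnth w i == letter_b) i ^ k)).
  (* At most [n] terms, each at most [n ^ 4], stay below the modulus. *)
  rewrite /= modn_small // ltnS expnSr.
  rewrite big_mkcond -[X in _ <= _ * X]card_ord mulnC -sum_nat_const.
  rewrite leq_sum // => i _.
  case: ifP => // _; apply: leq_trans (_ : n ^ k <= _).
    by case: (val k) => // e; rewrite leq_exp2r // ltnW.
  by rewrite leq_pexp2l // -ltnS.
rewrite (big_morph _ inZpD inZp0) [RHS]big_mkcond.
by apply: eq_bigr => i _; rewrite ffunE; case: ifP.
Qed.

(** Here [w] is arbitrary, so no word outside the language shares its moments with a word inside it;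
    this makes the output test sound. *)
Lemma word_moments_inj (v w : n.-tuple ab) : 0 < n ->
  lang_ababa v -> word_moments v = word_moments w -> v = w.
Proof.
move=> n_gt0 /lang_ababa_cuts[cuts cuts4 v_cuts] eq_vw.
have eq_b : (fun i => tnth v i == letter_b) =1 (fun i => tnth w i == letter_b).
  apply: (@moments_determine_sign_set rat n 5 (cut_poly rat cuts)).
  - by rewrite size_cut_poly cuts4.
  - move=> i; have := @sgr_cut_poly rat cuts i; rewrite cuts4 => /(_ isT).
    rewrite -v_cuts ?size_tuple // -tnth_nth.
    case: ifP => _ /eqP.
      by rewrite opprK sgr_cp0.
    by rewrite sgr_cp0.
  - by move=> k; rewrite -!word_momentsE // eq_vw.
apply: eq_from_tnth => i; move: (eq_b i).
by case: (tnth v i); case: (tnth w i).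
Qed.

Lemma moment_algorithm_decides : 0 < n ->
  ooo_decides lang_ababa moment_algorithm.
Proof.
move=> n_gt0 w pi; rewrite moment_run /=; split=> [/existsP[v]|Lw].
  by case/andP=> /asboolP Lv /eqP /(word_moments_inj n_gt0 Lv) <-.
by apply/existsP; exists w; rewrite eqxx andbT; apply/asboolP.
Qed.

Lemma card_moment_state : #|{: moment_state}| <= 2 ^ (25 * (trunc_log 2 n).+1).
Proof.
(* One factor 5 counts the moments, the other is the exponent in the modulus. *)
rewrite card_ffun !card_ord -[25]/(5 * 5) -mulnA mulnC expnM leq_exp2r //.
rewrite mulnC expnM.
apply: leq_trans (_ : n.+1 ^ 5 <= _); first by rewrite ltn_exp2r.
by rewrite leq_exp2r // trunc_log_ltn.
Qed.
End MomentAlgorithm.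

Section TruncLog.
Local Open Scope ring_scope.
Local Open Scope classical_set_scope.

Lemma trunc_log_bigO (R : realType) (a : nat) :
  (fun n : nat => (a * (trunc_log 2 n).+1)%:R : R) =O_\oo
  (fun n : nat => ln n%:R : R).
Proof.
(* The factor 2 comes from [t.+1 <= 2 * t] for a positive logarithm [t]; the successor keeps the
   constant positive when [a = 0]. *)
apply/eqO_exP; exists ((a * 2).+1%:R / ln 2).
  by rewrite divr_gt0 // ln_gt0 // ltr1n.
near=> n.
have n_gt1 : (1 < n)%N by near: n; exact: nbhs_infty_gt.
set t := trunc_log 2 n.
have t_gt0 : (0 < t)%N by rewrite trunc_log_gt0.
have ln2_gt0 : 0 < ln 2 :> R by rewrite ln_gt0 // ltr1n.
have le_t : t%:R * ln 2 <= ln n%:R :> R.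
  rewrite mulr_natl -lnXn // ler_ln ?posrE ?exprn_gt0 ?ltr0n //; last by lia.
  by rewrite -natrX ler_nat trunc_logP //; lia.
rewrite ger0_norm ?ler0n // ger0_norm; last first.
  by apply: le_trans le_t; rewrite mulr_ge0 // ltW.
rewrite mulrAC ler_pdivlMr //.
apply: le_trans (_ : (a * 2)%:R * (t%:R * ln 2) <= _).
  rewrite mulrA ler_wpM2r ?(ltW ln2_gt0) // -natrM ler_nat -mulnA leq_mul2l.
  by lia.
by rewrite ler_pM ?ler_nat ?mulr_ge0 ?(ltW ln2_gt0).
Unshelve. all: by end_near.
Qed.
End TruncLog.

Theorem proposition5p2 (R : realType) :
  ooo_space_complexity lang_ababa (fun n : nat => ln (n%:R)%R : R).
Proof.
exists (fun n => 25 * (trunc_log 2 n).+1); split; last exact: trunc_log_bigO.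
exists moment_algorithm => n n_gt0; split; first exact: card_moment_state.
exact: moment_algorithm_decides.
Qed.
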